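(* Let $v:\mathbb{R}\to\mathbb{R}$ be such that the settling-time function $\mathcal{T}$ of the scalar system $\dot x=v(x)$ satisfies $\sup_{x_0\in\mathbb{R}}\mathcal{T}(x_0)\le T_f<\infty$ for a known $T_f$, and such that $v(\cdot)^2$ is non-decreasing for non-negative arguments. Let $T_c>0$. Using such $v$, $T_f$ and some $\alpha\ge0$, construct for the scalar system $\dot x=u$, $x(0)=x_0$, the control $$u(t)=\kappa(t)v(x(t)),\quad t\in[0,T_c),\qquad \kappa(t)=\frac{\eta}{\alpha(T_c-\eta t)},\qquad \eta=1-\exp(-\alpha T_f),$$ and denote by $$E(\alpha)=\int_0^{T_c}u(\xi)^2\,\mathrm{d}\xi$$ the resulting energy. Then there always exists $\alpha^*_{x_0}$, which may depend on $x_0$, such that $E(\alpha^*_{x_0})\le E(\alpha)$ for all $\alpha\ge0$. In particular, $E(\alpha^*_{x_0})<E(0)$ for all $x_0\ne0$.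
   Context: For $\alpha=0$ the gain is the limit $\kappa(t)=\lim_{\alpha\to0}\frac{\eta}{\alpha(T_c-\eta t)}=T_f/T_c$. Since $E(\alpha)$ is defined only for $\alpha\ge0$, $\alpha^*_{x_0}$ is a non-negative real. Solutions are understood in the sense of Filippov, and the origin is assumed to be an equilibrium of $\dot x=v(x)$ (the solution starting at $0$ stays at $0$). The settling-time function is $\mathcal{T}(x_0):=\inf\{\xi\ge0:\lim_{\tau\to\xi}x(\tau;x_0)=0\}$, where $x(\tau;x_0)$ is the solution of $\frac{\mathrm{d}x}{\mathrm{d}\tau}=v(x)$ with $x(0;x_0)=x_0$. There is no disturbance.
   Formalization: For x0<0 the strict inequality E(α* )<E(0) is claimed only if v² is also non-increasing for non-positive arguments (it can fail otherwise); the origin being an equilibrium is taken to include v(0)=0. *)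

(* Defs.v *)
From HB Require Import structures.
From mathcomp Require Import all_boot all_order all_algebra.
From mathcomp Require Import all_classical all_reals all_analysis.
Set Implicit Arguments.
Unset Strict Implicit.
Unset Printing Implicit Defensive.
Import Order.TTheory GRing.Theory Num.Theory.
Import numFieldNormedType.Exports.
Local Open Scope classical_set_scope.
Local Open Scope ring_scope.

Definition abs_continuous_on (R : realType) (a b : R) (x : R -> R) : Prop :=
  forall e : R, 0 < e -> exists2 d : R, 0 < d &
    forall (n : nat) (l r : 'I_n -> R),
      (forall i, a <= l i /\ l i <= r i /\ r i <= b) ->
      trivIset [set: 'I_n] (fun i => `]l i, r i[%classic) ->
      \sum_(i < n) (r i - l i) < d ->
      \sum_(i < n) `|x (r i) - x (l i)| < e.

(* Filippov's convexification: the intersection, over all radii d > 0 and all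
   Lebesgue-null sets N, of the closed convex hull of f (ball y d \ N). On the
   real line the convex hull of a set is its interval hull. *)
Definition filippov (R : realType) (f : R -> R) (y : R) : set R :=
  [set z | forall (d : R) (N : set R), 0 < d ->
    (@lebesgue_measure R).-negligible N ->
    closure [set` Rhull (f @` (ball y d `\` N))] z].

(* Filippov solutions on [0, b[ of x'(t) = f t (x t), x(0) = x0. The values of
   the total function x outside [0, b[ are irrelevant. *)
Definition filippov_solution (R : realType) (f : R -> R -> R) (b : \bar R)
    (x0 : R) (x : R -> R) : Prop :=
  [/\ x 0 = x0,
      forall c : R, 0 <= c -> (c%:E < b)%E -> abs_continuous_on 0 c x &
      {ae @lebesgue_measure R, forall t : R, 0 < t -> (t%:E < b)%E ->
         derivable x t 1 /\ filippov (f t) (x t) (derive1 x t)}].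

(* [phi x0] is the solution of x' = v x started at x0: it exists on [0, +oo[,
   and it is the only one, on every [0, b[. *)
Definition solution_map (R : realType) (v : R -> R) (phi : R -> R -> R) : Prop :=
  (forall x0 : R, filippov_solution (fun=> v) +oo%E x0 (phi x0)) /\
  (forall (b : \bar R) (x0 : R) (y : R -> R),
     filippov_solution (fun=> v) b x0 y ->
     forall t : R, 0 <= t -> (t%:E < b)%E -> y t = phi x0 t).

(* Filippov solutions do not see the value of v on a null set, so the two
   conjuncts are independent. *)
Definition origin_equilibrium (R : realType) (v : R -> R) (phi : R -> R -> R) :
    Prop :=
  v 0 = 0 /\ forall t : R, 0 <= t -> phi 0 t = 0.

(* The limit is taken inside the time domain [0, +oo[; the infimum is +oo when
   the trajectory never tends to 0 in finite time. *)
Definition settling_time (R : realType) (phi : R -> R -> R) (x0 : R) : \bar R :=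
  ereal_inf [set xi%:E | xi in [set xi : R | 0 <= xi /\
    phi x0 t @[t --> within `[0, +oo[%classic (nbhs xi)] --> (0 : R)]].

Definition eta (R : realType) (Tf alpha : R) : R := 1 - expR (- (alpha * Tf)).

(* At alpha = 0 the gain is the limit of the formula as alpha tends to 0. *)
Definition gain (R : realType) (Tf Tc alpha t : R) : R :=
  if alpha == 0 then Tf / Tc
  else eta Tf alpha / (alpha * (Tc - eta Tf alpha * t)).

Definition closed_loop (R : realType) (v : R -> R) (Tf Tc alpha x0 : R)
    (x : R -> R) : Prop :=
  filippov_solution (fun t y => gain Tf Tc alpha t * v y) Tc%:E x0 x.

(* Extended-real valued. The integrand is nonnegative, so the integral is
   meaningful for every v; if v is Lebesgue but not Borel measurable it is
   still the usual one, being a supremum over simple minorants. *)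
Definition energy (R : realType) (v : R -> R) (Tf Tc alpha : R) (x : R -> R) :
    \bar R :=
  (\int[@lebesgue_measure R]_(t in `[0%R, Tc[%classic)
     ((gain Tf Tc alpha t * v (x t)) ^+ 2)%:E)%E.

(* Main.v *)
Require Import Defs.
From HB Require Import structures.
From mathcomp Require Import all_boot all_order all_algebra.
From mathcomp Require Import all_classical all_reals all_analysis.
From mathcomp Require Import measurable_realfun ring lra.
Import Order.TTheory GRing.Theory Num.Theory.
Import numFieldNormedType.Exports.
Local Open Scope classical_set_scope.
Local Open Scope ring_scope.

(** Why the theorem is true.  Write A(alpha) for the integral of
    u |-> exp(- alpha u) over [0, Tf] (elapsed alpha Tf).  The map
    s |-> (Tc / A(alpha)) * elapsed alpha s (stretch) sends [0, Tf[ onto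
    [0, Tc[, and its derivative at s is the inverse of the gain at the image
    of s.  Composed with it, a closed-loop trajectory becomes a Filippov
    solution of x' = v x, hence the one given by phi
    (closed_loop_stretch).  The change of variables then gives
    (energy_weight)
      E(alpha) = integral over [0, Tf[ of (A(alpha) / Tc) exp(alpha s) g(s),
      with g(s) = v(phi x0 s)^2,
    where the trajectory, hence g, no longer depends on alpha.

    A minimizer exists because of two bounds on the weight in front of g.
    Between alpha and beta the weights differ at most by the factor
    exp(2 Tf |alpha - beta|), so that E is either infinite everywhere or
    finite and continuous; and the weight grows at least like alpha s^2, so
    that E is either zero or coercive (weighted_energy_argmin).  Nothing makes
    v measurable on the negative axis, so these comparisons, like the change of
    variables, are proved for integrals of arbitrary nonnegative functions,
    that is, for lower integrals.

    For the strict inequality v^2 is monotone on the side of x0.  A nonzero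
    value cannot be taken twice by a trajectory, for it would then be
    periodic and never settle; hence |phi x0 s| decreases and g is
    nonincreasing.  A trajectory started at 2 x0 needs a positive time to reach
    x0, hence phi x0 has settled at some T1 < Tf (flow_settles_early).
    Chebyshev's inequality on [0, T1] bounds the integral of exp(alpha s) g(s)
    by the mean of exp(alpha s) times the integral of g (chebyshev_expR), and
    for a well-chosen alpha > 0 the product of this mean with A(alpha) is
    smaller than Tf = A(0), because T1 < Tf (elapsed_mul_lt).  As the integral
    of g is positive and finite, E(alpha) < E(0) (weighted_energy_lt). *)

(** * Integrals of nonnegative functions without measurability *)

Section lower_integral.
Local Open Scope ereal_scope.
Context {d} {T : measurableType d} {R : realType}.
Variable mu : {measure set T -> \bar R}.

Import HBNNSimple.

Lemma ge0_le_integral_nonmeasurable (D : set T) (F G : T -> \bar R) :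
  (forall x, D x -> 0 <= F x) -> (forall x, D x -> F x <= G x) ->
  \int[mu]_(x in D) F x <= \int[mu]_(x in D) G x.
Proof.
move=> F0 FG; have G0 x : D x -> 0 <= G x.
  by move=> Dx; exact: le_trans (F0 _ Dx) (FG _ Dx).
rewrite !ge0_integralE//; apply: le_ereal_sup => _ [h hF <-]; exists h => //= x.
by apply: le_trans (hF x) _; exact: lee_restrict.
Qed.

(** The integral of a nonnegative function is a supremum over simple
    minorants, and a minorant on D extended by 0 is one of them. *)
Lemma integral_le_nnsfun (D : set T) (F : T -> \bar R) (M : \bar R) :
  (forall x, D x -> 0 <= F x) ->
  (forall h : {nnsfun T >-> R}, (forall x, D x -> (h x)%:E <= F x) ->
    \int[mu]_(x in D) (h x)%:E <= M) ->
  \int[mu]_(x in D) F x <= M.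
Proof.
move=> F0 FM; rewrite ge0_integralE//; apply: ge_ereal_sup => _ [h hF <-].
have hD x : D x -> (h x)%:E <= F x.
  by move=> Dx; have := hF x; rewrite patchT// inE.
rewrite -integralT_nnsfun; apply: le_trans (FM h hD).
rewrite [leRHS]integral_mkcond.
apply: ge0_le_integral_nonmeasurable => // x _; first by rewrite lee_fin.
rewrite patchE; case: ifPn => // xD; have := hF x.
by rewrite patchE (negbTE xD).
Qed.

(** For a simple minorant h of F, the function h / k is a minorant of G, and its
    integral is that of h divided by k. *)
Lemma ge0_integral_le_scale (D : set T) (F G : T -> \bar R) (k : R) :
  measurable D -> (0 < k)%R ->
  (forall x, D x -> 0 <= F x) -> (forall x, D x -> F x <= k%:E * G x) ->
  \int[mu]_(x in D) F x <= k%:E * \int[mu]_(x in D) G x.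
Proof.
move=> mD k0 F0 FG; apply: integral_le_nnsfun => // h hF.
rewrite -lee_pdivrMl// -ge0_integralZl_EFin//; last 3 first.
- by move=> x _; rewrite lee_fin.
- by apply/measurable_EFinP; exact: measurable_funTS.
- by rewrite invr_ge0 ltW.
apply: ge0_le_integral_nonmeasurable => x Dx.
  by rewrite mule_ge0// lee_fin// invr_ge0 ltW.
by rewrite lee_pdivrMl//; exact: le_trans (hF _ Dx) (FG _ Dx).
Qed.

End lower_integral.

(** * Measures with a density *)

Definition density {d} {T : measurableType d} {R : realType}
  (mu : {measure set T -> \bar R}) (f : T -> \bar R) (A : set T) : \bar R :=
  (\int[mu]_(x in A) f x)%E.

Section density.
Context {d} {T : measurableType d} {R : realType}.
Variables (mu : {sigma_finite_measure set T -> \bar R}) (f : T -> \bar R).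
Hypothesis f_ge0 : forall x, (0 <= f x)%E.
Hypothesis f_int : mu.-integrable setT f.

Local Notation nu := (density mu f).

Let mf : measurable_fun setT f := measurable_int _ f_int.

Let nu0 : nu set0 = 0%E. Proof. exact: integral_set0. Qed.

Let nu_ge0 A : (0 <= nu A)%E. Proof. exact: integral_ge0. Qed.

Let nu_sigma_additive : semi_sigma_additive nu.
Proof.
move=> F mF tF mUF; rewrite /density ge0_integral_bigcup//; last first.
  exact: measurable_funTS.
by apply: is_cvg_nneseries => n _ _; exact: integral_ge0.
Qed.

HB.instance Definition _ := isMeasure.Build _ _ _ nu nu0 nu_ge0
  nu_sigma_additive.

Let nu_fin : fin_num_fun nu.
Proof.
move=> A mA; apply: (integrable_fin_num mA).
exact: (integrableS measurableT).
Qed.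

HB.instance Definition _ := Measure_isFinite.Build _ _ _ nu nu_fin.

(** Used with the rays as generators: the finiteness of the density measure is
    what makes the uniqueness theorem applicable. *)
Lemma density_unique (G : set (set T)) (g : (set T)^nat)
    (m : {measure set T -> \bar R}) :
  measurable = <<s G >> -> setI_closed G -> (forall i, G (g i)) ->
  \bigcup_k g k = setT -> (forall A, G A -> m A = nu A) ->
  forall A, measurable A -> m A = nu A.
Proof.
move=> mG GI Gg gT mE A mA; apply/esym.
apply: (measure_unique G g mG GI Gg gT (density mu f) m) => //.
- by move=> B GB; rewrite mE.
- move=> k; have mgk : measurable (g k) by rewrite mG; exact: sub_sigma_algebra.
  by rewrite ltey_eq nu_fin.
Qed.

(** The Radon-Nikodym derivative of the density measure agrees almost
    everywhere with f, since both have the same integrals over all measurable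
    sets. *)
Lemma integral_density (m : {measure set T -> \bar R}) (D : set T)
    (h : T -> \bar R) :
  measurable D -> (forall A, measurable A -> A `<=` D ->
    m A = (\int[mu]_(x in A) f x)%E) ->
  (forall x, (0 <= h x)%E) -> measurable_fun D h ->
  (\int[m]_(x in D) h x = \int[mu]_(x in D) (h x * f x))%E.
Proof.
move=> mD mE h_ge0 mh.
have dom : nu `<< mu.
  apply/null_content_dominatesP => A mA muA.
  by apply: null_set_integral => //; exact: measurable_funTS.
rewrite (eq_measure_integral nu)//.
rewrite -(Radon_Nikodym_SigmaFinite.change_of_variables dom)//.
have iRN := Radon_Nikodym_SigmaFinite.f_integrable dom.
have mRN := measurable_int _ iRN.
apply: ge0_ae_eq_integral => //.
- by apply: emeasurable_funM => //; exact: measurable_funTS mRN.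
- by apply: emeasurable_funM => //; exact: measurable_funTS.
- by move=> x _; apply: mule_ge0 => //; exact: Radon_Nikodym_SigmaFinite.f_ge0.
- by move=> x _; exact: mule_ge0.
- have : ae_eq mu D (Radon_Nikodym_SigmaFinite.f nu mu) f.
    apply: integral_ae_eq => //.
    + exact: integrableS iRN.
    + exact: measurable_funTS.
    + by move=> A _ mA; rewrite -Radon_Nikodym_SigmaFinite.f_integral.
  by apply: filterS => x /[apply] ->.
Qed.

End density.

(** * Change of variables along an increasing map *)

Section gt0_derive_change.
Context {R : realType}.
Variables (tau dtau : R -> R) (a b : R).
Hypothesis tau_derive : forall s : R, is_derive s 1 tau (dtau s).
Hypothesis dtau_gt0 : forall s, 0 < dtau s.

Lemma is_derive_continuous : continuous tau.
Proof.
move=> s; apply/differentiable_continuous/derivable1_diffP.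
exact: (@ex_derive _ _ _ _ _ _ _ (tau_derive s)).
Qed.

Lemma is_derive_within (A : set R) : {within A, continuous tau}.
Proof. exact/continuous_subspaceT/is_derive_continuous. Qed.

Lemma is_derive_MVT s t : s < t -> exists2 c, s < c < t &
  tau t - tau s = dtau c * (t - s).
Proof.
move=> st.
have [c] := MVT st (fun x _ => tau_derive x) (is_derive_within _).
by rewrite in_itv/= => ? ?; exists c.
Qed.

Lemma gt0_derive_lt : {mono tau : s t / s < t}.
Proof.
apply: leW_mono; apply: le_mono => s t st.
have [c _ E] := is_derive_MVT _ _ st.
by rewrite -subr_gt0 E mulr_gt0 ?subr_gt0.
Qed.

Lemma gt0_derive_le : {mono tau : s t / s <= t}.
Proof. by move=> s t; rewrite !leNgt gt0_derive_lt. Qed.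

Lemma gt0_derive_surj t : a < b -> tau a <= t < tau b ->
  exists s, a <= s < b /\ tau s = t.
Proof.
move=> ab /andP[at_ tb].
have mM : Num.min (tau a) (tau b) <= t <= Num.max (tau a) (tau b).
  by rewrite min_l ?max_r ?at_ ?(ltW tb)// gt0_derive_le ltW.
have [s + tsE] := IVT (ltW ab) (is_derive_within _) mM.
rewrite in_itv/= => /andP[as_ sb]; exists s; split => //.
by rewrite as_ -gt0_derive_lt tsE.
Qed.

Hypothesis dtau_cont : continuous dtau.
Hypothesis ab : a < b.

Local Notation mu := (@lebesgue_measure R).

Lemma derive_measurable (A : set R) : measurable_fun A dtau.
Proof. by apply: measurable_funTS; exact: continuous_measurable_fun. Qed.

Lemma integral_gt0_derive c d : c < d ->
  (\int[mu]_(s in `[c, d[) (dtau s)%:E = (tau d - tau c)%:E)%E.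
Proof.
move=> cd; rewrite integral_itv_bndo_bndc; last first.
  by apply/measurable_EFinP; exact: derive_measurable.
rewrite (@continuous_FTC2 _ _ tau)//.
- exact/continuous_subspaceT.
- split.
  + by move=> x _; exact: (@ex_derive _ _ _ _ _ _ _ (tau_derive x)).
  + exact/cvg_at_right_filter/is_derive_continuous.
  + exact/cvg_at_left_filter/is_derive_continuous.
- by move=> x _; rewrite derive1E (@derive_val _ _ _ _ _ _ _ (tau_derive x)).
Qed.

(** The values outside of [tau a, tau b[ are chosen so that the function is
    nondecreasing on the whole line, hence Borel, and that the preimage of
    [a, b[ is exactly [tau a, tau b[. *)
Definition gt0_derive_inv t : R :=
  if t < tau a then a - 1 else if tau b <= t then b else
  xget a [set s | a <= s < b /\ tau s = t].

Lemma gt0_derive_invP t : tau a <= t < tau b ->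
  a <= gt0_derive_inv t < b /\ tau (gt0_derive_inv t) = t.
Proof.
move=> /andP[at_ tb]; rewrite /gt0_derive_inv (ltNge t) at_/= (leNgt (tau b)) tb/=.
case: xgetP => [s _ //|/(_ _)].
have [s sP] := gt0_derive_surj t ab ltac:(by rewrite at_ tb).
by move=> /(_ s).
Qed.

Lemma gt0_derive_inv_itv t : (a <= gt0_derive_inv t < b) = (tau a <= t < tau b).
Proof.
apply/idP/idP => [|/gt0_derive_invP[]//].
have [ta|at_] := ltP t (tau a).
  by rewrite /gt0_derive_inv ta => /andP[]; rewrite lerBrDr gerDl ler10.
have [//|bt] := ltP t (tau b).
by rewrite /gt0_derive_inv (ltNge t) at_/= bt ltxx andbF.
Qed.

Lemma gt0_derive_invK s : a <= s < b -> gt0_derive_inv (tau s) = s.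
Proof.
move=> sab; have [|_ E] := gt0_derive_invP (tau s).
  by rewrite gt0_derive_le gt0_derive_lt.
by apply/eqP; rewrite eq_le -[_ <= s]gt0_derive_le -[s <= _]gt0_derive_le E lexx.
Qed.

Lemma gt0_derive_inv_nondecreasing : nondecreasing_fun gt0_derive_inv.
Proof.
move=> s t st.
have [ta|at_] := ltP t (tau a).
  by rewrite /gt0_derive_inv ta (le_lt_trans st ta).
have [sa|as_] := ltP s (tau a).
  have -> : gt0_derive_inv s = a - 1 by rewrite /gt0_derive_inv sa.
  have [tb|bt] := ltP t (tau b).
    have [/andP[+ _] _] := gt0_derive_invP t ltac:(by rewrite at_ tb).
    by apply: le_trans; rewrite gerBl.
  by rewrite /gt0_derive_inv (ltNge t) at_/= bt lerBlDr ltW// ltr_wpDr.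
have [tb|bt] := ltP t (tau b).
  have [_ E] := gt0_derive_invP t ltac:(by rewrite at_ tb).
  have [_ F] := gt0_derive_invP s ltac:(by rewrite as_ (le_lt_trans st tb)).
  by rewrite -gt0_derive_le E F.
have -> : gt0_derive_inv t = b by rewrite /gt0_derive_inv (ltNge t) at_/= bt.
have [sb|bs] := ltP s (tau b).
  by have [/andP[_ /ltW]] := gt0_derive_invP s ltac:(by rewrite as_ sb).
by rewrite /gt0_derive_inv (ltNge s) as_/= bs.
Qed.

Lemma gt0_derive_inv_measurable (A : set R) :
  measurable A -> measurable_fun A gt0_derive_inv.
Proof. by move=> mA; exact: nondecreasing_measurable gt0_derive_inv_nondecreasing. Qed.

Let D : set (measurableTypeR R) := `[a, b[%classic.

Let mD : measurable D. Proof. exact: measurable_itv. Qed.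

Let f : measurableTypeR R -> \bar R := (EFin \o dtau) \_ D.

Let f_ge0 s : (0 <= f s)%E.
Proof. by apply: erestrict_ge0 => x _; rewrite lee_fin ltW. Qed.

Let f_int : mu.-integrable setT f.
Proof.
apply/integrable_restrict => //; rewrite setTI.
apply/integrableP; split; first by apply/measurable_EFinP; exact: derive_measurable.
under eq_integral do rewrite gee0_abs ?lee_fin ?ltW//.
by rewrite integral_gt0_derive// ltry.
Qed.

Let push : {measure set (measurableTypeR R) -> \bar R} :=
  measure_function_pushforward__canonical__measure_function_Measure mu
    (gt0_derive_inv_measurable setT measurableT :
      @measurable_fun _ _ (measurableTypeR R) (measurableTypeR R) setT gt0_derive_inv).

(* On the ray [x, +oo[ both sides are an increment of tau: the length of the
   interval [tau y, tau b[ and the integral of the derivative over [y, b[, with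
   y = max x a. *)
Let mE A : measurable A -> mrestr push mD A = density mu f A.
Proof.
apply: (@density_unique _ _ _ mu f f_ge0 f_int (@RGenCInfty.G R)
  (fun k => `[- k%:R, +oo[%classic) (mrestr push mD)).
- exact: RGenCInfty.measurableE.
- move=> _ _ [x ->] [y ->]; exists (Num.max x y).
  apply/seteqP; split => t /=; rewrite !in_itv/= !andbT ge_max; last by move/andP.
  by move=> [-> ->].
- by move=> k; exists (- k%:R).
- apply/seteqP; split => // t _; exists (Num.trunc (- t)).+1 => //=.
  by rewrite in_itv/= andbT lerNl ltW// truncnS_gt.
- move=> _ [x ->]; rewrite /density -integral_mkcondr.
  change (mu (gt0_derive_inv @^-1` (`[x, +oo[%classic `&` D)) =
    \int[mu]_(s in `[x, +oo[%classic `&` D) (dtau s)%:E)%E.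
  have [bx|xb] := leP b x.
    rewrite (_ : _ `&` D = set0) ?preimage_set0 ?measure0 ?integral_set0//.
    apply/seteqP; split => // t []; rewrite /D/= !in_itv/= andbT => xt.
    by move=> /andP[_ /(le_lt_trans (le_trans bx xt))]; rewrite ltxx.
  have yb : Num.max x a < b by rewrite gt_max xb.
  have -> : `[x, +oo[%classic `&` D = `[Num.max x a, b[%classic.
    apply/seteqP; split => t; rewrite /D/= !in_itv/= andbT ge_max.
      by move=> [-> /andP[-> ->]].
    by move=> /andP[/andP[-> ->] ->].
  rewrite integral_gt0_derive//.
  rewrite (_ : _ @^-1` _ = `[tau (Num.max x a), tau b[%classic).
    by rewrite lebesgue_measure_itv/= lte_fin gt0_derive_lt yb.
  apply/seteqP; split => t /=; rewrite !in_itv/= => /andP[yt tb].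
    have /gt0_derive_invP[tab E] : tau a <= t < tau b.
      by rewrite -gt0_derive_inv_itv tb (le_trans _ yt)// le_max lexx orbT.
    by rewrite -E gt0_derive_le gt0_derive_lt yt.
  have tab : tau a <= t < tau b.
    by rewrite tb (le_trans _ yt)// gt0_derive_le le_max lexx orbT.
  have [/andP[_ ->] E] := gt0_derive_invP _ tab.
  by rewrite -gt0_derive_le E yt.
Qed.

(** The image of the Lebesgue measure under the inverse of tau has density
    dtau. *)
Lemma ge0_integral_change_measurable (h : measurableTypeR R -> \bar R) :
  (forall t, (0 <= h t)%E) -> measurable_fun setT h ->
  (\int[mu]_(t in `[tau a, tau b[) h t =
   \int[mu]_(s in `[a, b[) (h (tau s) * (dtau s)%:E))%E.
Proof.
move=> h_ge0 mh.
have mtau : @measurable_fun _ _ (measurableTypeR R) (measurableTypeR R) setT tau.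
  by apply: continuous_measurable_fun; exact: is_derive_continuous.
transitivity (\int[push]_(s in D) h (tau s))%E.
  have preD : `[tau a, tau b[%classic = gt0_derive_inv @^-1` D.
    by apply/seteqP; split => t; rewrite /D/= !in_itv/= gt0_derive_inv_itv.
  have -> : (\int[push]_(s in D) h (tau s) =
      \int[mu]_(t in `[tau a, tau b[) h (tau (gt0_derive_inv t)))%E.
    rewrite preD.
    apply: (@ge0_integral_pushforward _ _ (measurableTypeR R) (measurableTypeR R)
      R gt0_derive_inv (gt0_derive_inv_measurable setT measurableT) mu D
      (h \o tau)) => //; last by move=> s _; exact: h_ge0.
    by apply: measurable_funTS; exact: (measurableT_comp mh).
  by apply: eq_integral => t; rewrite inE/= in_itv/= => /gt0_derive_invP[_ ->].
rewrite (@integral_density _ _ _ mu f f_ge0 f_int)//.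
- by apply: eq_integral => s sD; rewrite /f patchT.
- by move=> A mA AD; have := mE A mA; rewrite /mrestr setIidl.
- by apply: measurable_funTS; exact: (measurableT_comp mh).
Qed.


Import HBNNSimple.

(** F is arbitrary: a simple minorant of either side is transported by tau or by
    its inverse to a Borel minorant of the other side, to which the Borel case
    applies. *)
Lemma ge0_integral_change (F : R -> \bar R) : (forall t, (0 <= F t)%E) ->
  (\int[mu]_(t in `[tau a, tau b[) F t =
   \int[mu]_(s in `[a, b[) (F (tau s) * (dtau s)%:E))%E.
Proof.
move=> F0; apply/eqP; rewrite eq_le; apply/andP; split.
  apply: integral_le_nnsfun => // h hF.
  rewrite (ge0_integral_change_measurable (EFin \o h)).
  - apply: ge0_le_integral_nonmeasurable => s /=; rewrite in_itv/= => sab.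
      by rewrite -EFinM lee_fin mulr_ge0// ltW.
    apply: lee_wpmul2r; first by rewrite lee_fin ltW.
    apply: hF; rewrite /=.
    by rewrite in_itv/= gt0_derive_le gt0_derive_lt.
  - by move=> t; rewrite lee_fin.
  - exact/measurable_EFinP.
apply: integral_le_nnsfun => // [s _|k kF].
  by rewrite mule_ge0// lee_fin ltW.
pose h t := (k (gt0_derive_inv t) / dtau (gt0_derive_inv t))%:E.
have h0 t : (0 <= h t)%E by rewrite lee_fin divr_ge0// ltW.
have mh : @measurable_fun _ _ (measurableTypeR R) _ setT h.
  apply/measurable_EFinP/measurable_funM.
    apply: (@measurableT_comp _ _ _ _ _ _ k) => //.
    exact: (gt0_derive_inv_measurable setT).
  apply: (@measurableT_comp _ _ _ _ _ _ (fun s => (dtau s)^-1)); last first.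
    exact: (gt0_derive_inv_measurable setT).
  apply: continuous_measurable_fun => s; apply: cvgV; last exact: dtau_cont.
  by rewrite gt_eqF.
apply: (@le_trans _ _ (\int[mu]_(t in `[tau a, tau b[) h t)%E).
  rewrite (ge0_integral_change_measurable h)//.
  apply: ge0_le_integral_nonmeasurable => s; first by rewrite lee_fin.
  rewrite /= in_itv/= => sab.
  by rewrite /h gt0_derive_invK// -EFinM divfK// gt_eqF.
apply: ge0_le_integral_nonmeasurable => // t; rewrite /= in_itv/=.
move=> /gt0_derive_invP[sab E]; rewrite /h EFinM lee_pdivrMr//.
by have := kF (gt0_derive_inv t); rewrite /= in_itv/= E; exact.
Qed.

(** The change of variables applied to the indicator of a null set, whose
    integral is 0, while dtau is positive. *)
Lemma negligible_preimage (N : set R) : mu.-negligible N ->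
  mu.-negligible (tau @^-1` N `&` `[a, b[%classic).
Proof.
move=> [B [mB B0 NB]].
have mtau : @measurable_fun _ _ (measurableTypeR R) (measurableTypeR R) setT tau.
  by apply: continuous_measurable_fun; exact: is_derive_continuous.
have := ge0_integral_change (fun t => (\1_B t)%:E) ltac:(move=> t; by rewrite lee_fin).
rewrite integral_indic//= (_ : mu (B `&` _) = 0%E); last first.
  by apply/eqP; rewrite -measure_le0 -B0 le_measure// inE//; exact: measurableI.
move=> /esym I0.
have : ae_eq mu D (fun s => (\1_B (tau s))%:E * (dtau s)%:E)%E (cst 0%E).
  apply/ae_eq_integral_abs => //.
    apply: emeasurable_funM; apply/measurable_EFinP; last exact: derive_measurable.
    by apply: measurable_funTS; apply: measurableT_comp.
  rewrite -[RHS]I0; apply: eq_integral => s _.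
  by rewrite gee0_abs// -EFinM lee_fin mulr_ge0// ltW.
apply: negligibleS => s [Ns sab] /(_ sab)/=.
rewrite indicE mem_set; last exact: NB.
by rewrite mul1e => -[]; apply/eqP; rewrite gt_eqF.
Qed.

End gt0_derive_change.

(** * Filippov solutions and changes of time *)

Section filippov_theory.
Context {R : realType}.

(** Scaling by k > 0 is a homeomorphism that maps interval hulls to interval
    hulls. *)
Lemma filippovZ (f : R -> R) (k y z : R) : 0 < k ->
  filippov f y z -> filippov (fun w => k * f w) y (k * z).
Proof.
move=> k0 fz d N d0 N0; have {}fz := fz d N d0 N0.
set A := ball y d `\` N in fz *.
have kV : continuous (fun w : R => k * w).
  by move=> w; apply: cvgM; [exact: cvg_cst|exact: cvg_id].
have hullZ w : [set` Rhull (f @` A)] w ->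
    [set` Rhull ((fun w => k * f w) @` A)] (k * w).
  rewrite !Rhull_smallest => fw X [iX AX].
  apply: (fw [set w | X (k * w)]); split.
    move=> u v Xu Xv t /andP[ut tv].
    by apply: (iX (k * u) (k * v)) => //; rewrite !ler_pM2l ?ut.
  by move=> _ [u Au <-]; apply: AX; exists u.
move=> B nB; have [w [wA wB]] := fz _ (kV z _ nB).
by exists (k * w); split => //; exact: hullZ.
Qed.

(** Absolute continuity with a single interval. *)
Lemma filippov_solution_within (f : R -> R -> R) (b : \bar R) (x0 : R) (x : R -> R)
    (c : R) : 0 <= c -> (c%:E < b)%E ->
  filippov_solution f b x0 x -> {within `[0, c], continuous x}.
Proof.
move=> c0 cb [_ xac _]; apply/subspace_continuousP => s.
rewrite /= in_itv/= => /andP[s0 sc].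
apply/cvgrPdist_lt => e e0; have [d d0 H] := xac c c0 cb e e0.
rewrite near_withinE; near=> t => /=; rewrite in_itv/= => /andP[t0 tc].
have K u v : 0 <= u -> u <= v -> v <= c -> v - u < d -> `|x v - x u| < e.
  move=> u0 uv vc uvd.
  have := H 1%N (fun=> u) (fun=> v); rewrite !big_ord1; apply => //.
  by move=> i j _ _ _; rewrite !ord1.
have std : `|s - t| < d by near: t; exact: cvgr_dist_lt.
have [st|/ltW ts] := leP s t.
  rewrite distrC; apply: K => //; apply: le_lt_trans std.
  by rewrite distrC ler_norm.
by apply: K => //; apply: le_lt_trans std; rewrite ler_norm.
Unshelve. all: by end_near. Qed.

(** The bound L makes tau Lipschitz, which preserves absolute continuity; the
    exceptional set of times is pulled back to a null set because dtau is
    positive. *)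
Lemma filippov_solution_time_change (f g : R -> R -> R) (b b' : \bar R) (x0 L : R)
    (x tau dtau : R -> R) :
  (forall s : R, is_derive s 1 tau (dtau s)) -> (forall s, 0 < dtau s) ->
  continuous dtau ->
  0 <= tau 0 -> (forall s, 0 <= s -> dtau s <= L) ->
  (forall s, 0 <= s -> (s%:E < b')%E -> ((tau s)%:E < b)%E) ->
  (forall s, 0 < s -> (s%:E < b')%E -> g s = fun y => dtau s * f (tau s) y) ->
  filippov_solution f b x0 x ->
  filippov_solution g b' (x (tau 0)) (x \o tau).
Proof.
move=> dt dt0 ct tau0 tL taub gE [_ xac xder].
have ltau := gt0_derive_lt tau dtau dt dt0.
have letau := gt0_derive_le tau dtau dt dt0.
have L0 : 0 < L by exact: lt_le_trans (dt0 0) (tL 0 (lexx _)).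
have tau_ge0 s : 0 <= s -> 0 <= tau s.
  by move=> s0; rewrite (le_trans tau0)// letau.
split=> //.
- move=> c c0 cb e e0.
  have [d d0 H] := xac (tau c) (tau_ge0 _ c0) (taub _ c0 cb) e e0.
  exists (d / L); first by rewrite divr_gt0.
  move=> n l r lr tri sd; apply: (H n (tau \o l) (tau \o r)) => /=.
  + move=> i; have [l0 [lri rc]] := lr i.
    by rewrite !letau lri rc tau_ge0.
  + move=> i j _ _ [t [/=]]; rewrite !in_itv/= => /andP[li ri] /andP[lj rj].
    have ii : l i < r i by rewrite -ltau (lt_trans li).
    have ij : l i < r j by rewrite -ltau (lt_trans li).
    have ji : l j < r i by rewrite -ltau (lt_trans lj).
    have jj : l j < r j by rewrite -ltau (lt_trans lj).
    (* overlapping images have overlapping sources, since tau is increasing *)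
    have m : Num.max (l i) (l j) < Num.min (r i) (r j).
      by rewrite gt_max !lt_min ii ij ji jj.
    have [m1 m2] := midf_lt m.
    apply: tri => //; exists ((Num.max (l i) (l j) + Num.min (r i) (r j)) / 2).
    move: m1 m2; rewrite gt_max lt_min => /andP[m1 m2] /andP[m3 m4].
    by split; rewrite /= in_itv/= ?m1 ?m2 ?m3 ?m4.
  + apply: (@le_lt_trans _ _ (L * \sum_(i < n) (r i - l i))); last first.
      by rewrite mulrC -ltr_pdivlMr.
    rewrite mulr_sumr; apply: ler_sum => i _.
    have [l0 [lri _]] := lr i.
    move: lri; rewrite le_eqVlt => /predU1P[->|lri]; first by rewrite !subrr mulr0.
    have [u /andP[lu ur] ->] := is_derive_MVT tau dtau dt _ _ lri.
    by rewrite ler_wpM2r ?subr_ge0 ?(ltW lri)// tL// (le_trans l0) ?ltW.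
- pose N : set R := ~` [set t | 0 < t -> (t%:E < b)%E ->
    derivable x t 1 /\ filippov (f t) (x t) (derive1 x t)].
  have null n : (@lebesgue_measure R).-negligible
      ((tau @^-1` N) `&` `[0, n.+1%:R[%classic).
    exact: (negligible_preimage tau dtau 0 n.+1%:R dt dt0 ct (ltr0Sn _ _) N).
  apply: negligibleS (negligible_bigcup null) => s /= /not_implyP[s0].
  move=> /not_implyP[sb nQ]; exists (Num.trunc s) => //; split; last first.
    by rewrite /= in_itv/= ltW//= -truncn_lt_nat// ltW.
  move=> /= Q; apply: nQ.
  have [//|xd xF] := Q _ (taub _ (ltW s0) sb).
    by rewrite (le_lt_trans tau0)// ltau.
  have td : derivable tau s 1 by exact: (@ex_derive _ _ _ _ _ _ _ (dt s)).
  have xtd : is_derive s 1 (x \o tau) (x^`()%classic (tau s) * dtau s).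
    by apply: is_derive1_comp; apply: DeriveDef => //; rewrite derive1E.
  split; first exact: (@ex_derive _ _ _ _ _ _ _ xtd).
  rewrite derive1E (@derive_val _ _ _ _ _ _ _ xtd) gE// mulrC.
  exact: filippovZ.
Qed.

End filippov_theory.

(** * The flow of a system that settles in bounded time *)

Section flow.
Context {R : realType}.
Variables (v : R -> R) (phi : R -> R -> R) (Tf : R).
Hypothesis v_phi : solution_map v phi.
Hypothesis v_eq : origin_equilibrium v phi.
Hypothesis settle : (ereal_sup (range (settling_time phi)) <= Tf%:E)%E.

Lemma flow_start x0 : phi x0 0 = x0.
Proof. by have [/(_ x0)[]] := v_phi. Qed.

Lemma flow_within x0 a c : 0 <= a -> {within `[a, c], continuous (phi x0)}.
Proof.
move=> a0; have [c0|c0] := leP 0 c; last first.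
  rewrite set_itv_ge; first exact: continuous_subspace0.
  by rewrite bnd_simp -ltNge (lt_le_trans c0).
have [/(_ x0) sol _] := v_phi.
apply: continuous_subspaceW (filippov_solution_within _ _ _ _ _ c0 (ltry _) sol).
by move=> t /=; rewrite !in_itv/= => /andP[at_ ->]; rewrite (le_trans a0).
Qed.

(** Translating time gives a solution again, and solutions are unique. *)
Lemma flowD x0 s t : 0 <= s -> 0 <= t -> phi x0 (s + t) = phi (phi x0 s) t.
Proof.
move=> s0 t0; have [sol uniq] := v_phi.
have sol' : filippov_solution (fun=> v) +oo%E (phi x0 s) (phi x0 \o (+%R s)).
  rewrite -{1}[s]addr0.
  apply: (filippov_solution_time_change (fun=> v) (fun=> v) +oo%E +oo%E x0 1
    (phi x0) (+%R s) (fun=> 1)) => //.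
  - by move=> u; apply: is_derive_eq; rewrite add0r.
  - by move=> u; exact: cvg_cst.
  - by rewrite addr0.
  - by move=> u _ _; exact: ltry.
  - by move=> u _ _; apply/funext => y; rewrite mul1r.
by rewrite -(uniq _ _ _ sol' t t0 (ltry _)).
Qed.

Lemma flow_settled x0 s t : 0 <= s -> s <= t -> phi x0 s = 0 -> phi x0 t = 0.
Proof.
move=> s0 st xs; rewrite -[t](subrKC s) flowD ?subr_ge0// xs.
by have [_ ->] := v_eq; rewrite ?subr_ge0.
Qed.

Lemma flow_settles x0 t : Tf < t -> phi x0 t = 0.
Proof.
move=> Tt.
have : (settling_time phi x0 < t%:E)%E.
  apply: (@le_lt_trans _ _ Tf%:E); last by rewrite lte_fin.
  by apply: le_trans settle; apply: ereal_sup_ubound; exists x0.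
move=> /ereal_inf_lt[_ [xi [xi0 xiC] <-]]; rewrite lte_fin => /ltW xit.
apply: (flow_settled _ _ _ xi0 xit).
apply/eqP; rewrite -normr_le0; apply/ler_addgt0Pl => e e0; rewrite addr0.
have /cvgrPdist_lt/(_ e e0) := xiC; rewrite near_withinE => near0.
have := nbhs_singleton near0; rewrite /= in_itv/= andbT => /(_ xi0).
by rewrite sub0r normrN => /ltW.
Qed.

(** A value taken twice makes the trajectory periodic from then on, while it
    has settled by any time after Tf. *)
Lemma flow_no_return x0 s t : 0 <= s -> s < t -> phi x0 s = phi x0 t ->
  phi x0 s = 0.
Proof.
move=> s0 st E; set p := t - s.
have p0 : 0 < p by rewrite subr_gt0.
have spE : s + p = t by rewrite /p subrKC.
have per n : phi (phi x0 s) (p *+ n) = phi x0 s.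
  elim: n => [|n IH]; first by rewrite mulr0n flow_start.
  rewrite mulrS flowD ?mulrn_wge0 ?(ltW p0)//.
  by rewrite -(flowD x0) ?(ltW p0)// spE -E.
rewrite -(per (Num.trunc (Tf / p)).+1); apply: flow_settles.
rewrite -mulr_natl -ltr_pdivrMr//.
exact: truncnS_gt.
Qed.

Lemma flow_IVT x0 s t y : 0 <= s -> s <= t ->
  Num.min (phi x0 s) (phi x0 t) <= y <= Num.max (phi x0 s) (phi x0 t) ->
  exists2 u, s <= u <= t & phi x0 u = y.
Proof.
move=> s0 st yst; have [u] := IVT st (flow_within _ _ _ s0) yst.
by rewrite in_itv/=; exists u.
Qed.

(** A change of sign goes through 0, where the trajectory stays. *)
Lemma flow_sign x0 s t : 0 <= s -> s <= t -> 0 <= phi x0 s * phi x0 t.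
Proof.
move=> s0 st; rewrite leNgt; apply/negP => neg.
have [|u /andP[su ut] u0] := flow_IVT x0 s t 0 s0 st.
  rewrite ge_min le_max.
  have [A|A] := leP (phi x0 s) 0; have [B|B] := leP (phi x0 t) 0;
    rewrite ?(ltW A) ?(ltW B) ?orbT//.
    by move: neg; rewrite ltNge mulr_le0.
  by move: neg; rewrite ltNge mulr_ge0 ?ltW.
move: neg; rewrite (flow_settled _ _ _ _ ut u0) ?mulr0 ?ltxx//.
exact: le_trans su.
Qed.

(** If the norm increased, the trajectory would come back to an earlier nonzero
    value on its way to 0. *)
Lemma flow_norm_noninc x0 s t : 0 <= s -> s <= t -> `|phi x0 t| <= `|phi x0 s|.
Proof.
move=> s0 st; rewrite leNgt; apply/negP => lt_st.
set w := Num.max t (Tf + 1).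
have tw : t <= w by rewrite le_max lexx.
have w0 : phi x0 w = 0 by apply: flow_settles; rewrite lt_max ltrDl ltr01 orbT.
have t0 : 0 <= t by exact: le_trans st.
have sgn := flow_sign x0 s t s0 st.
have xs0 : phi x0 s != 0.
  apply: contraTneq lt_st => xs0.
  by rewrite (flow_settled _ _ _ s0 st xs0) normr0 -leNgt.
have [|u /andP[tu uw] uE] := flow_IVT x0 t w (phi x0 s) t0 tw.
  rewrite w0 ge_min le_max; move: lt_st sgn; case: (ltgtP (phi x0 s) 0) xs0 => // A _.
    rewrite nmulr_rge0// => + B; rewrite !ler0_norm ?(ltW A)//.
    by rewrite ltrN2 => /ltW ->; rewrite orbT.
  rewrite pmulr_rge0// => + B; rewrite !ger0_norm ?(ltW A)//.
  by move=> /ltW ->; rewrite orbT.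
move/eqP: xs0; apply; apply: (flow_no_return x0 s u s0) => //.
rewrite lt_neqAle (le_trans st)// andbT; apply: contraTneq lt_st => su.
by rewrite -leNgt (_ : t = s)//; apply/eqP; rewrite eq_le st su tu.
Qed.

Lemma flow_sign0 x0 s : 0 <= s -> 0 <= x0 * phi x0 s.
Proof. by move=> s0; have := flow_sign x0 0 s (lexx _) s0; rewrite flow_start. Qed.

(** The trajectory started at 2 x0 takes some time s > 0 to reach x0, and its
    total settling time is also at most Tf. *)
Lemma flow_settles_early x0 : x0 != 0 ->
  exists T1, [/\ 0 < T1, T1 < Tf & forall t, T1 <= t -> phi x0 t = 0].
Proof.
move=> x00; set w := Num.max 0 (Tf + 1).
have w0 : 0 <= w by rewrite le_max lexx.
have [|s /andP[s0 sw] sE] := flow_IVT (x0 *+ 2) 0 w x0 (lexx _) w0.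
  rewrite flow_start flow_settles; last by rewrite lt_max ltrDl ltr01 orbT.
  rewrite ge_min le_max; have [A|A] := leP 0 x0; rewrite ?(ltW A) ?orbT//.
    by rewrite mulr2n lerDl A andbT.
  by rewrite mulr2n gerDl (ltW A).
have sgt0 : 0 < s.
  rewrite lt_neqAle s0 andbT; apply: contraNneq x00 => sE0.
  by move/eqP: sE; rewrite -sE0 flow_start -subr_eq0 mulr2n addrK.
have zero t : Tf - s < t -> 0 <= t -> phi x0 t = 0.
  move=> st t0; rewrite -sE -flowD//; apply: flow_settles.
  by rewrite -ltrBlDl.
have Ts : s <= Tf.
  rewrite leNgt; apply/negP => Ts; move/eqP: x00; apply.
  by rewrite -(flow_start x0) zero// subr_lt0.
(* the settling times are known to be at most Tf, not attained: half of the
   margin s is given up to get a closed half-line *)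
have Ts' : 0 < Tf - s / 2 by lra.
exists (Tf - s / 2); split => //; first by lra.
move=> t Tt; apply: zero; first by lra.
by rewrite (le_trans _ Tt)// ltW.
Qed.

Variable x0 : R.
Hypothesis x0_neq0 : x0 != 0.
Hypothesis v2_side : forall y z, 0 <= x0 * y -> 0 <= x0 * z -> `|y| <= `|z| ->
  v y ^+ 2 <= v z ^+ 2.

Lemma flow_v2_noninc s t : 0 <= s -> s <= t ->
  v (phi x0 t) ^+ 2 <= v (phi x0 s) ^+ 2.
Proof.
move=> s0 st; apply: v2_side; rewrite ?flow_sign0 ?(le_trans s0)//.
exact: flow_norm_noninc.
Qed.

(** If v y = 0 then, by monotonicity, v vanishes between 0 and y, so that the
    constant y / 2 is a Filippov solution; but it never settles. *)
Lemma v_neq0_side y : 0 < x0 * y -> v y != 0.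
Proof.
move=> x0y; apply/negP => /eqP vy.
have y0 : y != 0 by apply: contraTneq x0y => ->; rewrite mulr0 ltxx.
have vz z : 0 <= x0 * z -> `|z| <= `|y| -> v z = 0.
  move=> x0z zy; apply/eqP; rewrite -sqrf_eq0 eq_le sqr_ge0 andbT.
  by rewrite -[leRHS](expr0n _ 2) -vy v2_side// ltW.
set z := y / 2.
have sol : filippov_solution (fun=> v) +oo%E z (cst z).
  split=> //.
    move=> c c0 _ e e0; exists 1 => // n l r _ _ _.
    by rewrite big1// => i _; rewrite subrr normr0.
  apply: aeW => t t0 _; split; first exact: derivable_cst.
  rewrite derive1_cst => d N d0 N0.
  apply: subset_closure; apply: sub_Rhull.
  (* a null set cannot contain an interval around y / 2, and v vanishes on the
     points of this interval *)
  set r := Num.min d (`|y| / 2).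
  have r0 : 0 < r by rewrite lt_min d0 divr_gt0// normr_gt0.
  have [w wr nNw] : exists2 w, `]z - r, z + r[%classic w & ~ N w.
    apply: contrapT => /forall2NP nw.
    have nI : (@lebesgue_measure R).-negligible `]z - r, z + r[%classic.
      by apply: negligibleS N0 => w wr; have [|/contrapT] := nw w.
    have mI : measurable (`]z - r, z + r[%classic : set (measurableTypeR R)).
      exact: measurable_itv.
    have := measure_negligible mI nI.
    rewrite /= lebesgue_measure_itv/= lte_fin ltrD2l gtrN// => /eqP.
    rewrite -EFinB eqe.
    by rewrite opprD addrACA subrr add0r opprK gt_eqF// addr_gt0.
  have wz : `|w - z| < r.
    by move: wr; rewrite /= in_itv/= ltr_distl.
  have wy : `|w - z| <= `|y| / 2 by rewrite (le_trans (ltW wz))// ge_min lexx orbT.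
  exists w; last first.
    apply: vz.
      have -> : x0 * w = x0 * y / 2 + x0 * (w - z) by rewrite /z; field.
      have : `|x0 * (w - z)| <= x0 * y / 2.
        rewrite normrM -[x0 * y]gtr0_norm// normrM -mulrA.
        by rewrite ler_wpM2l.
      by rewrite ler_norml => /andP[]; lra.
    rewrite -[w](subrK z) (le_trans (ler_normD _ _))//.
    by rewrite /z normrM [`|2^-1|]gtr0_norm// in wy *; lra.
  split=> //; rewrite /ball/= distrC (lt_le_trans wz)//.
  by rewrite ge_min lexx.
have [_ uniq] := v_phi.
have := uniq _ _ _ sol (`|Tf| + 1) ltac:(by rewrite addr_ge0) (ltry _).
rewrite flow_settles; last by rewrite (le_lt_trans (ler_norm _))// ltrDl.
by rewrite /cst /z => /eqP; rewrite mulf_eq0 (negbTE y0) invr_eq0 pnatr_eq0.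
Qed.

Lemma flow_v_neq0 : exists2 r, 0 < r & v (phi x0 r) != 0.
Proof.
set w := Num.max 0 (Tf + 1).
have w0 : 0 <= w by rewrite le_max lexx.
have [|r /andP[r0 _] rE] := flow_IVT x0 0 w (x0 / 2) (lexx _) w0.
  rewrite flow_start flow_settles; last by rewrite lt_max ltrDl ltr01 orbT.
  by rewrite ge_min le_max; case: (ltgtP x0 0) => A; apply/andP; split; lra.
exists r; last first.
  apply: v_neq0_side; rewrite rE mulrA divr_gt0// lt_neqAle sqr_ge0.
  by rewrite eq_sym sqrf_eq0 x0_neq0.
rewrite lt_neqAle r0 andbT; apply: contraNneq x0_neq0 => r0E.
by move: rE; rewrite -r0E flow_start => /eqP; lra.
Qed.

End flow.

(** * Minimizers of coercive log-Lipschitz functions *)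

Section argmin.
Context {R : realType}.

(** The second bound makes E either infinite everywhere or finite and
    continuous; coercivity reduces the search to a segment. *)
Lemma coercive_argmin (E : R -> \bar R) (K c : R) : 0 < c ->
  (forall a, 0 <= a -> (0 <= E a)%E) ->
  (forall a b, 0 <= a -> 0 <= b -> (E a <= (expR (K * `|a - b|))%:E * E b)%E) ->
  (forall a, 1 <= a -> ((c * a)%:E <= E a)%E) ->
  exists2 a, 0 <= a & forall b, 0 <= b -> (E a <= E b)%E.
Proof.
move=> c0 E0 EK Ec.
have [Eoo|Eoo] := eqVneq (E 0) +oo%E.
  exists 0 => // b b0; have := EK 0 b (lexx _) b0; rewrite Eoo.
  by case: (E b) (E0 b b0) => [r| |]// _; rewrite -EFinM leye_eq.
have Efin a : 0 <= a -> E a \is a fin_num.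
  move=> a0; rewrite ge0_fin_numE ?E0//.
  apply: le_lt_trans (EK a 0 a0 (lexx _)) _.
  apply: lte_mul_pinfty; rewrite ?lee_fin ?expR_ge0//.
  by rewrite ltey.
(* evaluating at |a| extends the problem from the half-line to the whole line *)
pose r (a : R) := fine (E `|a|).
have rK (a b : R) : r a <= expR (K * `| `|a| - `|b| |) * r b.
  rewrite -lee_fin EFinM !fineK ?Efin//.
  by apply: EK.
have r0 a : 0 <= r a by rewrite fine_ge0 ?E0.
have rC : continuous r.
  move=> b; pose q (a : R) := expR (K * `| `|a| - `|b| |).
  have qC : q a @[a --> b] --> (1 : R).
    have -> : (1 : R) = expR (K * `| `|b| - `|b| |).
      by rewrite subrr normr0 mulr0 expR0.
    apply: (@cvg_comp _ _ _ _ expR); last exact: continuous_expR.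
    apply: cvgM; first exact: cvg_cst.
    by apply: cvg_norm; apply: cvgB; [exact: (cvg_norm cvg_id)|exact: cvg_cst].
  apply: (@squeeze_cvgr _ _ _ _ (fun a => (q a)^-1 * r b) (fun a => q a * r b)).
  - near=> a; apply/andP; split; last exact: rK.
    rewrite ler_pdivrMl ?expR_gt0//; have := rK b a.
    by rewrite distrC.
  - rewrite -[X in _ --> X]mul1r -(invr1 R); apply: cvgM; last exact: cvg_cst.
    by apply: cvgV => //; exact: oner_neq0.
  - by rewrite -[X in _ --> X]mul1r; apply: cvgM => //; exact: cvg_cst.
pose M := 1 + r 0 / c.
have M1 : 1 <= M by rewrite lerDl divr_ge0// ltW.
have M0 : 0 <= M by exact: le_trans M1.
have [a] := EVT_min M0 (continuous_subspaceT rC).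
rewrite in_itv/= => /andP[a0 aM] amin.
exists a => // b b0.
suff : r a <= r b by rewrite /r -lee_fin !ger0_norm// !fineK ?Efin.
have [bM|/ltW Mb] := leP b M; first by apply: amin; rewrite in_itv/= b0.
apply: (@le_trans _ _ (r 0)); first by apply: amin; rewrite in_itv/= lexx.
have cb : c * b <= r b.
  by rewrite -lee_fin /r ger0_norm// fineK ?Efin// Ec// (le_trans M1).
apply: le_trans cb; rewrite mulrC -ler_pdivrMr// (le_trans _ Mb)//.
by rewrite lerDr.
Unshelve. all: by end_near. Qed.

End argmin.

(** * The integral of an exponential *)

Section elapsed.
Context {R : realType}.

(** The integral of u |-> exp(- alpha u) over [0, s] (integral_elapsed); the
    case alpha = 0 is the limit of the quotient. *)
Definition elapsed (alpha s : R) : R :=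
  if alpha == 0 then s else (1 - expR (- (alpha * s))) / alpha.

Lemma elapsed0 alpha : elapsed alpha 0 = 0.
Proof. by rewrite /elapsed mulr0 oppr0 expR0 subrr mul0r if_same. Qed.

Lemma elapsed_derive alpha (s : R) :
  is_derive s 1 (elapsed alpha) (expR (- (alpha * s))).
Proof.
rewrite /elapsed; have [->|a0] := eqVneq alpha 0.
  by rewrite mul0r oppr0 expR0; exact: is_derive_id.
have dlin : is_derive s 1 (fun u => - (alpha * u)) (- (alpha * 1)).
  exact: (is_deriveN (is_deriveZ alpha (is_derive_id s 1))).
have dexp := @is_derive1_comp _ expR (fun u => - (alpha * u)) s _ _
  (is_derive_expR _) dlin.
have -> : (fun u => (1 - expR (- (alpha * u))) / alpha) =
    alpha^-1 \*: (cst 1 - (expR \o fun u => - (alpha * u))).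
  by apply/funext => u; rewrite /= mulrC.
have H := is_deriveZ alpha^-1 (is_deriveB (is_derive_cst (1 : R) s 1) dexp).
apply: (is_derive_eq H).
rewrite sub0r mulr1 mulrN opprK /GRing.scale/= mulrC mulfK//.
Qed.

Lemma elapsed_continuous_derive alpha : continuous (fun s : R => expR (- (alpha * s))).
Proof.
move=> s; apply: (@cvg_comp _ _ _ _ expR); last exact: continuous_expR.
by apply: cvgN; apply: cvgM; [exact: cvg_cst|exact: cvg_id].
Qed.

Lemma integral_elapsed alpha (s : R) : 0 < s ->
  (\int[lebesgue_measure]_(u in `[0%R, s[) (expR (- (alpha * u)))%:E =
   (elapsed alpha s)%:E)%E.
Proof.
move=> s0; have := integral_gt0_derive _ _ (elapsed_derive alpha)
  (elapsed_continuous_derive alpha) _ _ s0.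
by rewrite elapsed0 subr0.
Qed.

Lemma elapsed_gt0 alpha (s : R) : 0 < s -> 0 < elapsed alpha s.
Proof.
move=> s0; rewrite -[X in X < _](elapsed0 alpha).
by rewrite (gt0_derive_lt _ _ (elapsed_derive alpha))// => u; exact: expR_gt0.
Qed.

(** Compare the integrands of the two integrals. *)
Lemma elapsed_le_expR a b (s : R) : 0 < s ->
  elapsed a s <= expR (s * `|a - b|) * elapsed b s.
Proof.
move=> s0; rewrite -lee_fin EFinM -!integral_elapsed//.
apply: ge0_integral_le_scale => //; first exact: expR_gt0.
move=> u; rewrite /= in_itv/= => /andP[u0 us]; rewrite -EFinM lee_fin -expRD ler_expR.
suff : u * (b - a) <= s * `|a - b| by lra.
apply: le_trans (ler_norm _) _; rewrite normrM distrC ger0_norm//.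
by rewrite ler_wpM2r// ltW.
Qed.

End elapsed.

(** * The closed loop in the time of the autonomous system *)

Section reparametrization.
Context {R : realType}.
Variables (v : R -> R) (phi : R -> R -> R) (Tf Tc alpha x0 : R) (x : R -> R).
Hypothesis v_phi : solution_map v phi.
Hypothesis Tf_gt0 : 0 < Tf.
Hypothesis Tc_gt0 : 0 < Tc.
Hypothesis alpha_ge0 : 0 <= alpha.
Hypothesis x_sol : closed_loop v Tf Tc alpha x0 x.

(** The gain, seen in the time s of the autonomous system: gain_stretch. *)
Definition weight (Tf Tc alpha s : R) : R :=
  elapsed alpha Tf / Tc * expR (alpha * s).

Local Notation A := (elapsed alpha Tf).

Definition stretch s := Tc / A * elapsed alpha s.

Let A_gt0 : 0 < A. Proof. exact: elapsed_gt0. Qed.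

Lemma weight_gt0 s : 0 < weight Tf Tc alpha s.
Proof. by rewrite mulr_gt0 ?expR_gt0// divr_gt0. Qed.

Lemma stretch_derive (s : R) : is_derive s 1 stretch (weight Tf Tc alpha s)^-1.
Proof.
have -> : (weight Tf Tc alpha s)^-1 = Tc / A * expR (- (alpha * s)).
  by rewrite /weight invfM invf_div expRN.
exact: (is_deriveZ (Tc / A) (elapsed_derive alpha s)).
Qed.

Lemma weightV_continuous : continuous (fun s => (weight Tf Tc alpha s)^-1).
Proof.
move=> s; apply: cvgV; first by rewrite gt_eqF// weight_gt0.
apply: cvgM; first exact: cvg_cst.
apply: (@cvg_comp _ _ _ _ expR); last exact: continuous_expR.
by apply: cvgM; [exact: cvg_cst|exact: cvg_id].
Qed.

Lemma stretch0 : stretch 0 = 0.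
Proof. by rewrite /stretch elapsed0 mulr0. Qed.

Lemma stretchTf : stretch Tf = Tc.
Proof. by rewrite /stretch divfK// gt_eqF. Qed.

Lemma gain_stretch s : gain Tf Tc alpha (stretch s) = weight Tf Tc alpha s.
Proof.
have := A_gt0; rewrite /gain /weight /stretch /Defs.eta /elapsed.
have [->|a0] := eqVneq alpha 0; first by rewrite mul0r expR0 mulr1.
set e := expR (- (alpha * Tf)); rewrite -[in RHS](opprK (alpha * s)) [in RHS]expRN.
have := expR_gt0 (- (alpha * s)); set f := expR _ => f0 e0.
have e1 : 1 - e != 0 by apply: contraTneq e0 => ->; rewrite mul0r ltxx.
have -> : Tc - (1 - e) * (Tc / ((1 - e) / alpha) * ((1 - f) / alpha)) = Tc * f.
  by field; rewrite a0.
by field; rewrite a0 !gt_eqF.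
Qed.

Lemma closed_loop_stretch s : 0 <= s -> s < Tf -> x (stretch s) = phi x0 s.
Proof.
move=> s0 sT; have [_ uniq] := v_phi.
have [xx0 _ _] := x_sol.
have dgt0 u : 0 < (weight Tf Tc alpha u)^-1 by rewrite invr_gt0 weight_gt0.
have sol : filippov_solution (fun=> v) Tf%:E x0 (x \o stretch).
  rewrite -{1}xx0 -stretch0.
  apply: (filippov_solution_time_change _ _ _ _ _ (Tc / A) _ _ _
    stretch_derive _ weightV_continuous _ _ _ _ x_sol) => //.
  - by rewrite stretch0.
  - move=> u u0; rewrite /weight invfM invf_div ler_piMr ?divr_ge0 ?(ltW A_gt0) ?(ltW Tc_gt0)//.
    by rewrite invf_le1 ?expR_gt0// -expR0 ler_expR mulr_ge0.
  - move=> u u0; rewrite !lte_fin => uT; rewrite -stretchTf.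
    by rewrite (gt0_derive_lt _ _ stretch_derive).
  - move=> u u0 _; apply/funext => y.
    by rewrite gain_stretch mulKf// gt_eqF// weight_gt0.
by have := uniq _ _ _ sol s s0; rewrite lte_fin => /(_ sT).
Qed.

(** One of the two factors weight of the squared control is cancelled by the
    derivative of stretch. *)
Lemma energy_weight : energy v Tf Tc alpha x =
  (\int[lebesgue_measure]_(s in `[0%R, Tf[)
    (weight Tf Tc alpha s * v (phi x0 s) ^+ 2)%:E)%E.
Proof.
have dgt0 u : 0 < (weight Tf Tc alpha u)^-1 by rewrite invr_gt0 weight_gt0.
rewrite /energy -{1}stretch0 -{1}stretchTf.
rewrite (ge0_integral_change _ _ _ _ stretch_derive dgt0 weightV_continuous)//; last first.
  by move=> t; rewrite lee_fin sqr_ge0.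
apply: eq_integral => s; rewrite inE/= in_itv/= => /andP[s0 sT].
rewrite gain_stretch closed_loop_stretch// -EFinM; congr EFin.
by field; rewrite gt_eqF// weight_gt0.
Qed.

End reparametrization.

(** * Existence of an optimal parameter *)

Section weight_estimates.
Context {R : realType}.
Variables (Tf Tc : R).
Hypothesis Tf_gt0 : 0 < Tf.
Hypothesis Tc_gt0 : 0 < Tc.

Lemma weight_le_expR a b s : 0 <= s -> s <= Tf ->
  weight Tf Tc a s <= expR (2 * Tf * `|a - b|) * weight Tf Tc b s.
Proof.
move=> s0 sT; rewrite /weight.
have -> : 2 * Tf * `|a - b| = Tf * `|a - b| + Tf * `|a - b| by ring.
rewrite expRD.
have H1 := elapsed_le_expR a b Tf Tf_gt0.
have H2 : expR (a * s) <= expR (Tf * `|a - b|) * expR (b * s).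
  rewrite -expRD ler_expR.
  suff : s * (a - b) <= Tf * `|a - b| by lra.
  apply: le_trans (ler_norm _) _; rewrite normrM ger0_norm//.
  by rewrite ler_wpM2r.
have -> : forall e A B C : R, e * e * (A / B * C) = e * A / B * (e * C).
  by move=> e A B C; ring.
apply: ler_pM => //.
- by rewrite divr_ge0// ltW// elapsed_gt0.
- by rewrite ler_pM2r// invr_gt0.
Qed.

(** The factor elapsed decreases only like the inverse of a, while
    exp(a s) >= (1 + a s / 2)^2 grows like a^2 s^2. *)
Lemma weight_ge_sqr a s : 1 <= a -> 0 <= s ->
  (1 - expR (- Tf)) / (4 * Tc) * a * s ^+ 2 <= weight Tf Tc a s.
Proof.
move=> a1 s0; have a0 : 0 < a by exact: lt_le_trans a1.
have H1 : (1 - expR (- Tf)) / a <= elapsed a Tf.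
  rewrite /elapsed gt_eqF// ler_pM2r ?invr_gt0//.
  by rewrite lerD2l lerN2 ler_expR lerN2 ler_peMl// ltW.
have H2 : (a * s) ^+ 2 / 4 <= expR (a * s).
  have as0 : 0 <= a * s / 2 by rewrite divr_ge0// mulr_ge0// ltW.
  have -> : expR (a * s) = expR (a * s / 2) ^+ 2.
    by rewrite expr2 -expRD; congr expR; field.
  have -> : (a * s) ^+ 2 / 4 = (a * s / 2) ^+ 2 by field.
  rewrite ler_sqr ?nnegrE ?expR_ge0//.
  by apply: le_trans (expR_ge1Dx _); rewrite lerDr.
have e0 : 0 <= 1 - expR (- Tf).
  by rewrite subr_ge0 expR_le1 oppr_le0 ltW.
have -> : (1 - expR (- Tf)) / (4 * Tc) * a * s ^+ 2 =
    (1 - expR (- Tf)) / a / Tc * ((a * s) ^+ 2 / 4).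
  by field; rewrite !gt_eqF.
apply: ler_pM => //.
- by rewrite !divr_ge0// ltW.
- by rewrite divr_ge0 ?sqr_ge0.
- by rewrite ler_pM2r// invr_gt0.
Qed.

Local Notation mu := (@lebesgue_measure R).

Definition weighted_energy (g : R -> R) (a : R) : \bar R :=
  (\int[mu]_(s in `[0%R, Tf[) (weight Tf Tc a s * g s)%:E)%E.

Import HBNNSimple.

(** When the integral J of s^2 g vanishes, every simple minorant of g is null
    almost everywhere and the energy is identically 0; otherwise weight_ge_sqr
    makes it coercive. *)
Lemma weighted_energy_argmin (g : R -> R) : (forall s, 0 <= g s) ->
  exists2 a, 0 <= a & forall b, 0 <= b ->
    (weighted_energy g a <= weighted_energy g b)%E.
Proof.
move=> g0; set E := weighted_energy g.
have w0 a s := weight_gt0 Tf Tc a Tf_gt0 Tc_gt0 s.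
have E0 a : (0 <= E a)%E.
  by apply: integral_ge0 => s _; rewrite lee_fin mulr_ge0// ltW.
have EK a b : (E a <= (expR (2 * Tf * `|a - b|))%:E * E b)%E.
  apply: ge0_integral_le_scale => // [||s]; first exact: expR_gt0.
    by move=> s _; rewrite lee_fin mulr_ge0// ltW.
  rewrite /= in_itv/= => /andP[s0 /ltW sT].
  by rewrite -EFinM lee_fin mulrA ler_wpM2r// weight_le_expR.
set C := (1 - expR (- Tf)) / (4 * Tc).
have C0 : 0 < C.
  by rewrite divr_gt0 ?mulr_gt0// subr_gt0 expR_lt1 oppr_lt0.
set J := (\int[mu]_(s in `[0%R, Tf[) (s ^+ 2 * g s)%:E)%E.
have J0 : (0 <= J)%E.
  by apply: integral_ge0 => s _; rewrite lee_fin mulr_ge0// sqr_ge0.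
have JE a : 1 <= a -> (J <= ((C * a)^-1)%:E * E a)%E.
  move=> a1; have Ca : 0 < C * a by rewrite mulr_gt0// (lt_le_trans _ a1).
  apply: ge0_integral_le_scale => // [||s]; first by rewrite invr_gt0.
    by move=> s _; rewrite lee_fin mulr_ge0// sqr_ge0.
  rewrite /= in_itv/= => /andP[s0 _].
  rewrite -EFinM lee_fin mulrA ler_wpM2r// ler_pdivlMl//.
  exact: weight_ge_sqr.
have [Jz|Jnz] := eqVneq J 0%E.
  exists 0 => // b b0; suff E00 : (E 0%R <= 0)%E by exact: le_trans (E0 b).
  apply: integral_le_nnsfun => [s _|h hE]; first by rewrite lee_fin mulr_ge0// ltW.
  have mh : @measurable_fun _ _ (measurableTypeR R) _ `[0%R, Tf[%classic h.
    by exact: measurable_funTS.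
  have msq : @measurable_fun _ _ (measurableTypeR R) _ `[0%R, Tf[%classic
      (fun s : R => s ^+ 2).
    exact: exprn_measurable.
  have mF : @measurable_fun _ _ (measurableTypeR R) _ `[0%R, Tf[%classic
      (fun s => (s ^+ 2 * h s)%:E).
    by apply/measurable_EFinP; exact: measurable_funM.
  have F0 s : (0 <= (s ^+ 2 * h s)%:E)%E by rewrite lee_fin mulr_ge0// sqr_ge0.
  have I0 : (\int[mu]_(s in `[0%R, Tf[) `|(s ^+ 2 * h s)%:E| = 0)%E.
    under eq_integral do rewrite gee0_abs//.
    apply/eqP; rewrite eq_le integral_ge0// andbT.
    rewrite -(mule0 (Tf / Tc)%:E) -Jz.
    apply: ge0_integral_le_scale => // [|s Ds]; first exact: divr_gt0.
    have := hE s Ds; rewrite lee_fin => hs; rewrite -EFinM lee_fin mulrCA.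
    apply: ler_wpM2l; first exact: sqr_ge0.
    by apply: le_trans hs _; rewrite /weight mul0r expR0 mulr1 /elapsed eqxx.
  have mD : measurable (`[0%R, Tf[%classic : set (measurableTypeR R)).
    exact: measurable_itv.
  have F_ae0 := (ae_eq_integral_abs mu mD mF).1 I0.
  rewrite (@ae_eq_integral _ _ _ mu _ (cst 0%E))//.
  - by rewrite integral0.
  - exact/measurable_EFinP.
  have ne0 : mu.-negligible [set (0 : R)].
    by exists [set 0]; split => //; exact: lebesgue_measure_set1.
  apply: negligibleS (negligibleU ne0 F_ae0) => s /= nP.
  have [->|s0] := eqVneq s 0; [by left|right => /= P; apply: nP => Ds].
  have [/eqP] := P Ds; rewrite mulf_eq0 sqrf_eq0 (negbTE s0)/=.
  by move=> /eqP ->.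
have [c c0 cJ] : exists2 c : R, 0 < c & (c%:E <= J)%E.
  case: J J0 Jnz {JE} => [r| |]// r0 rn0; last by exists 1 => //; rewrite leey.
  exists r => //; rewrite -lte_fin lt_neqAle r0 eq_sym rn0//.
apply: (coercive_argmin E (2 * Tf) (c * C)) => //; first exact: mulr_gt0.
move=> a a1; have Ca : 0 < C * a by rewrite mulr_gt0// (lt_le_trans _ a1).
rewrite -mulrA mulrC EFinM -lee_pdivlMl//.
exact: le_trans cJ (JE a a1).
Qed.

End weight_estimates.

(** * Strict decrease of the energy *)

Section strict_decrease.
Context {R : realType}.

(** The trapezoidal rule overestimates the integral of a convex function. *)
Lemma expR_trapezoid (x : R) : 0 <= x -> 2 * (expR x - 1) <= x * (1 + expR x).
Proof.
move=> x0.
pose f := ((id : R -> R) * (cst 1 + expR)) - (2 \*: (expR - cst 1)) : R -> R.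
pose df := fun x : R => 1 - (1 - x) * expR x.
have fE u : f u = u * (1 + expR u) - 2 * (expR u - 1) by [].
have dfP (u : R) : is_derive u 1 f (df u).
  have H := is_deriveB (is_deriveM (is_derive_id u 1)
    (is_deriveD (is_derive_cst (1 : R) u 1) (is_derive_expR u)))
    (is_deriveZ 2 (is_deriveB (is_derive_expR u) (is_derive_cst (1 : R) u 1))).
  apply: (is_derive_eq H).
  change (u * (0 + expR u) + (1 + expR u) * 1 - 2 * (expR u - 0) = df u).
  by rewrite /df; ring.
have fC : {within `[0, x], continuous f}.
  by apply: derivable_within_continuous => u _; exact: (@ex_derive _ _ _ _ _ _ _ (dfP u)).
have [c] := MVT_segment x0 (fun u _ => dfP u) fC.
rewrite in_itv/= !fE expR0 subrr mul0r mulr0 !subr0 => /andP[c0 cx] E.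
rewrite -subr_ge0 E mulr_ge0// /df subr_ge0.
by rewrite -ler_pdivlMr ?expR_gt0// div1r -expRN expR_ge1Dx.
Qed.

(** To first order in alpha the left-hand side is
    Tf T1 (1 - alpha (Tf - T1) / 2).  With a = alpha Tf and b = alpha T1, the
    trapezoidal rule reduces the claim to (1 + exp(-a)) (1 + exp b) < 4, and
    1 + x <= exp x reduces it further to 3 a b < 2 (a - b), which holds for the
    alpha below. *)
Lemma elapsed_mul_lt (T1 Tf : R) : 0 < T1 -> T1 < Tf ->
  exists2 alpha, 0 < alpha & elapsed alpha Tf * elapsed (- alpha) T1 < Tf * T1.
Proof.
move=> T10 T1f; have Tf0 : 0 < Tf by exact: lt_trans T1f.
pose alpha := (Tf - T1) / (2 * T1 * Tf).
have al0 : 0 < alpha by rewrite divr_gt0 ?subr_gt0// !mulr_gt0.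
exists alpha => //.
rewrite /elapsed oppr_eq0 gt_eqF// mulNr opprK.
set a := alpha * Tf; set b := alpha * T1.
have a0 : 0 < a by rewrite mulr_gt0.
have b0 : 0 < b by rewrite mulr_gt0.
have ab : 3 * (a * b) < 2 * (a - b).
  have -> : 3 * (a * b) = alpha * (3 / 2 * (Tf - T1)).
    by rewrite /a /b /alpha; field; rewrite !gt_eqF.
  have -> : 2 * (a - b) = alpha * (2 * (Tf - T1)) by rewrite /a /b; ring.
  by rewrite ltr_pM2l// ltr_pM2r ?subr_gt0//; lra.
have b1 : b < 1.
  have -> : b = (1 - T1 / Tf) / 2 by rewrite /b /alpha; field; rewrite !gt_eqF.
  have : 0 < T1 / Tf by rewrite divr_gt0.
  lra.
have Eb : expR b * (1 - b) <= 1.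
  by rewrite -ler_pdivlMl ?expR_gt0// mulr1 -expRN expR_ge1Dx.
have Ea : expR (- a) * (1 + a) <= 1.
  by rewrite -ler_pdivlMl ?expR_gt0// mulr1 -expRN opprK expR_ge1Dx.
have Tb := expR_trapezoid b (ltW b0).
have Ta : 2 * (1 - expR (- a)) <= a * (1 + expR (- a)).
  have := expR_trapezoid a (ltW a0); rewrite -(ler_pM2l (expR_gt0 (- a))).
  have e1 : expR (- a) * expR a = 1 by rewrite -expRD addNr expR0.
  have -> : expR (- a) * (2 * (expR a - 1)) = 2 * (expR (- a) * expR a - expR (- a)) by ring.
  have -> : expR (- a) * (a * (1 + expR a)) = a * (expR (- a) + expR (- a) * expR a) by ring.
  by rewrite e1 [expR (- a) + 1]addrC.
have -> : (1 - expR (- a)) / alpha * ((1 - expR b) / - alpha) =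
    (1 - expR (- a)) * (expR b - 1) / alpha ^+ 2.
  by field; rewrite gt_eqF.
rewrite ltr_pdivrMr ?exprn_gt0//.
have -> : Tf * T1 * alpha ^+ 2 = a * b by rewrite /a /b; ring.
have p0 : 0 <= 1 - expR (- a) by rewrite subr_ge0 expR_le1 oppr_le0 ltW.
have q0 : 0 <= expR b - 1 by rewrite subr_ge0 ltW// expR_gt1.
have : 4 * ((1 - expR (- a)) * (expR b - 1)) <=
    (a * b) * ((1 + expR (- a)) * (1 + expR b)).
  have -> : 4 * ((1 - expR (- a)) * (expR b - 1)) =
    (2 * (1 - expR (- a))) * (2 * (expR b - 1)) by ring.
  have -> : (a * b) * ((1 + expR (- a)) * (1 + expR b)) =
    (a * (1 + expR (- a))) * (b * (1 + expR b)) by ring.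
  by apply: ler_pM => //; rewrite mulr_ge0.
have : (1 + expR (- a)) * (1 + expR b) < 4.
  have d0 : 0 < (1 + a) * (1 - b) by rewrite mulr_gt0 ?subr_gt0// addr_gt0.
  rewrite -(ltr_pM2r d0).
  apply: (@le_lt_trans _ _ ((2 + a) * (2 - b))); last by lra.
  have -> : (1 + expR (- a)) * (1 + expR b) * ((1 + a) * (1 - b)) =
    ((1 + a) + expR (- a) * (1 + a)) * ((1 - b) + expR b * (1 - b)) by ring.
  apply: ler_pM; [| |lra|lra].
    by rewrite addr_ge0 ?mulr_ge0 ?expR_ge0 ?addr_ge0// ltW.
  by rewrite addr_ge0 ?mulr_ge0 ?expR_ge0 ?subr_ge0// ltW.
rewrite -(ltr_pM2l (mulr_gt0 a0 b0)); lra.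
Qed.

Local Notation mu := (@lebesgue_measure R).

(** Chebyshev's inequality for an increasing and a nonincreasing function: with
    m the mean of exp(alpha s) over [0, b] and exp(alpha c) = m, the product
    (exp(alpha s) - m) (g s - g c) is nonpositive, and exp(alpha s) - m has
    integral 0. *)
Lemma chebyshev_expR (g : R -> R) (alpha b : R) :
  (forall s, 0 <= g s) -> nonincreasing_fun g -> 0 < alpha -> 0 < b ->
  (\int[mu]_(s in `[0%R, b[) (expR (alpha * s) * g s)%:E <=
   (elapsed (- alpha) b / b)%:E * \int[mu]_(s in `[0%R, b[) (g s)%:E)%E.
Proof.
move=> g0 gni al0 b0; set m := elapsed _ _ / b.
have m0 : 0 < m by rewrite divr_gt0// elapsed_gt0.
pose c := ln m / alpha.
have cE : expR (alpha * c) = m.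
  by rewrite /c mulrC divfK ?gt_eqF// lnK.
pose D : set (measurableTypeR R) := `[0, b[%classic.
have mD : measurable D by exact: measurable_itv.
have mg : @measurable_fun _ _ (measurableTypeR R) _ D g.
  exact: nonincreasing_measurable.
have me : @measurable_fun _ _ (measurableTypeR R) _ D (fun s => expR (alpha * s)).
  apply: nondecreasing_measurable => // s t st.
  by rewrite ler_expR ler_wpM2l// ltW.
have pt s : expR (alpha * s) * g s + g c * m <= m * g s + g c * expR (alpha * s).
  have [sc|/ltW cs] := leP s c.
    have : 0 <= (m - expR (alpha * s)) * (g s - g c).
      rewrite mulr_ge0// subr_ge0; last exact: gni.
      by rewrite -cE ler_expR ler_wpM2l// ltW.
    lra.
  have : 0 <= (expR (alpha * s) - m) * (g c - g s).
    rewrite mulr_ge0// subr_ge0; last exact: gni.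
    by rewrite -cE ler_expR ler_wpM2l// ltW.
  lra.
have I1 : (\int[mu]_(s in D) (g c * m)%:E = (g c * m * b)%:E)%E.
  rewrite integral_cst//.
  rewrite [RHS]EFinM; congr (_ * _)%E.
  have := lebesgue_measure_itv (`[0, b[ : interval R).
  by rewrite /= lte_fin b0 -EFinB subr0.
have I2 : (\int[mu]_(s in D) ((g c)%:E * (expR (alpha * s))%:E) = (g c * m * b)%:E)%E.
  rewrite ge0_integralZl_EFin//; last exact/measurable_EFinP.
  under eq_integral do rewrite -[alpha * _]opprK -mulNr.
  by rewrite integral_elapsed// -EFinM -mulrA divfK// gt_eqF.
rewrite -(@leeD2rE _ (g c * m * b)%:E)// -[in leLHS]I1 -I2.
rewrite -ge0_integralZl_EFin//; last 3 first.
- by move=> s _; rewrite lee_fin.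
- exact/measurable_EFinP.
- exact: ltW.
rewrite -!ge0_integralD//.
- apply: ge0_le_integral_nonmeasurable => s _.
    by rewrite -EFinD lee_fin addr_ge0// mulr_ge0// ?expR_ge0// ltW.
  by rewrite -!EFinM -!EFinD lee_fin.
- by move=> s _; rewrite -EFinM lee_fin mulr_ge0// ltW.
- by apply/measurable_EFinP; exact: measurable_funM.
- by move=> s _; rewrite -EFinM lee_fin mulr_ge0// expR_ge0.
- by apply/measurable_EFinP; exact: measurable_funM.
- by move=> s _; rewrite lee_fin mulr_ge0// expR_ge0.
- by apply/measurable_EFinP; exact: measurable_funM.
- by move=> s _; rewrite lee_fin mulr_ge0// ltW.
Qed.

(** As g vanishes after T1, only [0, T1] contributes; there its integral M is
    positive and finite, and the energy for alpha is at most M / Tc times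
    elapsed alpha Tf * elapsed (- alpha) T1 / T1 < Tf, while the energy for 0 is
    M / Tc times Tf. *)
Lemma weighted_energy_lt (Tf Tc T1 r : R) (g : R -> R) :
  0 < Tc -> 0 < T1 -> T1 < Tf ->
  (forall s, 0 <= g s) -> nonincreasing_fun g ->
  (forall s, T1 <= s -> g s = 0) -> 0 < r -> 0 < g r ->
  exists2 alpha, 0 < alpha &
    (weighted_energy Tf Tc g alpha < weighted_energy Tf Tc g 0)%E.
Proof.
move=> Tc0 T10 T1f g0 gni gT1 r0 gr.
have Tf0 : 0 < Tf by exact: lt_trans T1f.
have [alpha al0 lt] := elapsed_mul_lt T1 Tf T10 T1f.
exists alpha => //.
pose D : set (measurableTypeR R) := `[0, T1[%classic.
have mD : measurable D by exact: measurable_itv.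
have muD : mu D = T1%:E.
  have := lebesgue_measure_itv (`[0, T1[ : interval R).
  by rewrite /= lte_fin T10 -EFinB subr0.
have mg : @measurable_fun _ _ (measurableTypeR R) _ D g.
  exact: nonincreasing_measurable.
have me a : @measurable_fun _ _ (measurableTypeR R) _ D (fun s => expR (a * s) * g s).
  apply: measurable_funM => //; apply: measurable_funTS.
  apply: continuous_measurable_fun => s.
  apply: (@cvg_comp _ _ _ _ expR); last exact: continuous_expR.
  by apply: cvgM; [exact: cvg_cst|exact: cvg_id].
have weightedE a : (weighted_energy Tf Tc g a = (elapsed a Tf / Tc)%:E *
    \int[mu]_(s in D) (expR (a * s) * g s)%:E)%E.
  have c0 : 0 <= elapsed a Tf / Tc by rewrite divr_ge0 ?ltW// elapsed_gt0.
  rewrite -ge0_integralZl_EFin//; last 2 first.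
  - by move=> s _; rewrite lee_fin mulr_ge0// expR_ge0.
  - exact/measurable_EFinP.
  rewrite /weighted_energy [LHS]integral_mkcond [RHS]integral_mkcond.
  congr (integral _ _ _); apply/funext => s; rewrite !patchE.
  rewrite !mem_setE /D !in_itv/=.
  have [sT1|T1s] := ltP s T1.
    rewrite (lt_trans sT1 T1f); case: ifP => // _.
    by rewrite -EFinM /weight mulrA.
  by rewrite !andbF gT1// mulr0; case: ifP.
set M := (\int[mu]_(s in D) (g s)%:E)%E.
have MT : (M <= (g 0 * T1)%:E)%E.
  apply: (@le_trans _ _ (\int[mu]_(s in D) (g 0)%:E)%E).
    apply: ge0_le_integral_nonmeasurable => s; first by rewrite lee_fin.
    by rewrite /D/= in_itv/= => /andP[s0 _]; rewrite lee_fin gni.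
  by rewrite integral_cst// [leRHS]EFinM lee_wpmul2l ?lee_fin// -muD.
have rT1 : r < T1 by rewrite ltNge; apply: contraTN gr => /gT1 ->; rewrite ltxx.
have M0 : (0 < M)%E.
  apply: (@lt_le_trans _ _ (\int[mu]_(s in `[0%R, r[) (g r)%:E)%E).
    rewrite integral_cst//= lebesgue_measure_itv/= lte_fin r0.
    by rewrite -EFinB subr0 -EFinM lte_fin mulr_gt0.
  rewrite /M [leLHS]integral_mkcond [leRHS]integral_mkcond.
  apply: ge0_le_integral_nonmeasurable => s _.
    by apply: erestrict_ge0 => t _; rewrite lee_fin.
  rewrite !patchE !mem_setE /D !in_itv/=.
  case: (leP 0 s) => s0 //=; have [sr|rs] := ltP s r.
    by rewrite (lt_trans sr rT1) lee_fin gni// ltW.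
  by case: ifP => _; rewrite ?lee_fin.
have Mfin : M \is a fin_num by rewrite ge0_fin_numE ?ltW// (le_lt_trans MT)// ltry.
apply: (@le_lt_trans _ _ ((elapsed alpha Tf / Tc)%:E *
    ((elapsed (- alpha) T1 / T1)%:E * M))%E).
  rewrite weightedE lee_pmul2l ?fin_numE// ?lte_fin ?divr_gt0 ?elapsed_gt0//.
  exact: chebyshev_expR.
rewrite weightedE.
under eq_integral do rewrite mul0r expR0 mul1r.
rewrite -/M -(fineK Mfin) -!EFinM lte_fin mulrA ltr_pM2r ?fine_gt0 ?M0 ?ltey_eq ?Mfin//.
have -> : elapsed 0 Tf = Tf by rewrite /elapsed eqxx.
by rewrite mulrAC ltr_pM2r ?invr_gt0// mulrA ltr_pdivrMr.
Qed.

End strict_decrease.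

(** * The energy of the closed loop *)

Theorem proposition2 (R : realType) (v : R -> R) (phi : R -> R -> R) (Tf Tc : R)
    (v_phi : solution_map v phi)
    (v_eq : origin_equilibrium v phi)
    (settle : (ereal_sup (range (settling_time phi)) <= Tf%:E)%E)
    (v2_mono : forall y z : R, 0 <= y -> y <= z -> v y ^+ 2 <= v z ^+ 2)
    (Tc_gt0 : 0 < Tc)
    (x0 : R) (x : R -> R -> R)
    (x_sol : forall alpha : R, 0 <= alpha ->
       closed_loop v Tf Tc alpha x0 (x alpha)) :
  exists alphas : R,
    [/\ 0 <= alphas,
        forall alpha : R, 0 <= alpha ->
          (energy v Tf Tc alphas (x alphas) <= energy v Tf Tc alpha (x alpha))%E
      & x0 <> 0 ->
        (x0 < 0 -> forall y z : R, y <= z -> z <= 0 -> v z ^+ 2 <= v y ^+ 2) ->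
        (energy v Tf Tc alphas (x alphas) < energy v Tf Tc 0%R (x 0%R))%E].
Proof.
have Tf_gt0 : 0 < Tf.
  have [T1 [T10 T1f _]] := flow_settles_early v phi Tf v_phi v_eq settle 1 (oner_neq0 R).
  exact: lt_trans T1f.
(* the values of phi at negative times are arbitrary *)
pose g s := v (phi x0 (Num.max 0 s)) ^+ 2.
have g_ge0 s : 0 <= g s by exact: sqr_ge0.
have energyE alpha : 0 <= alpha ->
    energy v Tf Tc alpha (x alpha) = weighted_energy Tf Tc g alpha.
  move=> a0; rewrite (energy_weight v phi Tf Tc alpha x0 (x alpha))//; last exact: x_sol.
  apply: eq_integral => s; rewrite inE/= in_itv/= => /andP[s0 _].
  by rewrite /g max_r.
have [alphas as0 argmin] := weighted_energy_argmin Tf Tc Tf_gt0 Tc_gt0 g g_ge0.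
exists alphas; split => // [alpha a0|/eqP x0_neq0 v2_neg].
  by rewrite !energyE// argmin.
have side y z : 0 <= x0 * y -> 0 <= x0 * z -> `|y| <= `|z| -> v y ^+ 2 <= v z ^+ 2.
  case: (ltgtP x0 0) x0_neq0 => // x0_sgn _.
    rewrite !nmulr_rge0// => y0 z0; rewrite !ler0_norm// lerN2 => zy.
    exact: v2_neg.
  rewrite !pmulr_rge0// => y0 z0; rewrite !ger0_norm// => yz.
  exact: v2_mono.
have [T1 [T10 T1f xT1]] := flow_settles_early v phi Tf v_phi v_eq settle x0 x0_neq0.
have [r r0 vr] := flow_v_neq0 v phi Tf v_phi v_eq settle x0 x0_neq0 side.
have [||||alpha a0 lt] := weighted_energy_lt Tf Tc T1 r g Tc_gt0 T10 T1f g_ge0.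
- move=> s t st; apply: (flow_v2_noninc v phi Tf) => //.
    by rewrite le_max lexx.
  by rewrite ge_max !le_max lexx st orbT.
- move=> s T1s; have [v0 _] := v_eq.
  by rewrite /g xT1 ?v0 ?expr0n// le_max T1s orbT.
- exact: r0.
- by rewrite lt_neqAle g_ge0 andbT eq_sym sqrf_eq0 /g max_r// ltW.
rewrite !energyE//; apply: le_lt_trans lt; apply: argmin; exact: ltW.
Qed.
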